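(* Let $n \geq 5$ be an odd integer. Then Player $B$ has a winning strategy in the game $Z(n,d)$ for every integer $d$ with $\frac{n+3}{2} \leq d \leq n-1$.
   Context: For integers $n \geq 4$ and $d \geq 2$, $Z(n,d)$ is the following two-player game. Initially the board contains the numbers $1,2,\dots,n$. Players $A$ and $B$ alternately cross out (remove) one number from the board, with $A$ moving first, until exactly two numbers remain. If the sum of the two remaining numbers is divisible by $d$, $A$ wins; otherwise $B$ wins. A player has a winning strategy if that player can force a win regardless of the opponent's moves. *)

(* Defs.v *)
From mathcomp Require Import all_boot.

Set Implicit Arguments.
Unset Strict Implicit.
Unset Printing Implicit Defensive.

(* The game Z(n, d).  A history is the sequence of numbers crossed out so far,
   oldest first. *)

Inductive player := PlayerA | PlayerB.

Definition board (n : nat) (h : seq nat) : seq nat :=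
  [seq k <- iota 1 n | k \notin h].

Definition to_move (h : seq nat) : player :=
  if odd (size h) then PlayerB else PlayerA.

(* Play stops when exactly two numbers are left, so a history has at most
   n - 2 moves. *)
Definition legal_history (n : nat) (h : seq nat) : Prop :=
  [/\ uniq h, {subset h <= iota 1 n} & size h <= n - 2].

Definition finished (n : nat) (h : seq nat) : Prop := size (board n h) = 2.

Definition winner (n d : nat) (h : seq nat) : player :=
  if d %| sumn (board n h) then PlayerA else PlayerB.

(* A strategy sees the whole history; its values matter only at the histories
   where its owner is to move. *)
Definition strategy := seq nat -> nat.

Definition follows (P : player) (s : strategy) (h : seq nat) : Prop :=
  forall i, i < size h -> to_move (take i h) = P -> nth 0 h i = s (take i h).

(* The first clause makes a strategy answer with a number still on the board,
   so that a player cannot win vacuously by getting stuck. *)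
Definition winning_strategy (n d : nat) (P : player) (s : strategy) : Prop :=
  (forall h, legal_history n h -> follows P s h -> ~ finished n h ->
     to_move h = P -> s h \in board n h) /\
  (forall h, legal_history n h -> follows P s h -> finished n h ->
     winner n d h = P).

Definition has_winning_strategy (n d : nat) (P : player) : Prop :=
  exists s : strategy, winning_strategy n d P s.

(* Main.v *)
Require Import Defs.
From mathcomp Require Import all_boot zify.

Set Implicit Arguments.
Unset Strict Implicit.
Unset Printing Implicit Defensive.

(** Join two distinct numbers of the board when their sum is divisible by [d].
    [B] makes [(n - 2) / 2] moves, rounded down, and so wins by crossing out a
    vertex cover of this graph with at most that many elements.  Modulo [d], an
    edge joins the residue classes of [r] and [- r]; the cover consists of all
    the numbers in the smaller class of each such pair, and of [d / 2] when
    [d / 2] and [3 * d / 2] are both on the board. *)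

Implicit Types (n d k : nat) (C h : seq nat).

Lemma size_filter_le (T : Type) (a : pred T) (s : seq T) :
  size [seq x <- s | a x] <= size s.
Proof. by rewrite size_filter count_size. Qed.

Definition remaining (C h : seq nat) : seq nat := [seq k <- C | k \notin h].

Lemma mem_remaining C h k : (k \in remaining C h) = (k \notin h) && (k \in C).
Proof. exact: mem_filter. Qed.

Lemma remaining_rcons C h x :
  remaining C (rcons h x) = [seq k <- remaining C h | k != x].
Proof.
rewrite -filter_predI; apply: eq_filter => k /=.
by rewrite mem_rcons inE negb_or.
Qed.

Lemma perm_board_cat n h : uniq h -> {subset h <= iota 1 n} ->
  perm_eq (board n h ++ h) (iota 1 n).
Proof.
move=> h_uniq h_sub; rewrite perm_sym -(perm_filterC (fun k => k \notin h)).
rewrite perm_cat2l; apply: uniq_perm => // [|k].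
  exact/filter_uniq/iota_uniq.
by rewrite mem_filter /= negbK; apply/andb_idr/h_sub.
Qed.

Lemma size_board n h : uniq h -> {subset h <= iota 1 n} ->
  size (board n h) + size h = n.
Proof.
by move=> h_uniq /(perm_board_cat h_uniq)/perm_size; rewrite size_cat size_iota.
Qed.

Lemma follows_rcons P s h x : follows P s (rcons h x) ->
  follows P s h /\ (to_move h = P -> x = s h).
Proof.
move=> s_hx; split=> [i lt_ih|P_moves].
- have := s_hx i; rewrite size_rcons nth_rcons lt_ih.
  by rewrite -cats1 takel_cat 1?ltnW //; apply.
- have := s_hx (size h); rewrite size_rcons nth_rcons ltnn eqxx.
  by rewrite -cats1 take_size_cat //; apply.
Qed.

Definition cover_strategy (n : nat) (C : seq nat) : strategy :=
  fun h => head (head 0 (board n h)) (remaining C h).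

Lemma cover_strategy_board n C h : {subset C <= iota 1 n} ->
  0 < size (board n h) -> cover_strategy n C h \in board n h.
Proof.
move=> C_sub; rewrite /cover_strategy.
case remE: (remaining C h) => [|k s] /=.
  by case: (board n h) => // k s _; exact: mem_head.
have : k \in remaining C h by rewrite remE mem_head.
by rewrite mem_remaining mem_filter => /andP[-> /C_sub].
Qed.

Lemma size_remaining_cover_strategy n C h :
  follows PlayerB (cover_strategy n C) h ->
  size (remaining C h) <= size C - (size h)./2.
Proof.
elim/last_ind: h => [|h x IH] /=.
  by rewrite subn0 size_filter_le.
move=> /follows_rcons[/IH size_le]; rewrite remaining_rcons size_rcons.
rewrite /to_move; case: ifP => [h_odd /(_ erefl) ->|h_even _].
- rewrite /cover_strategy; case: (remaining C h) size_le => [|k s] //= size_le.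
  by rewrite eqxx /=; apply: leq_trans (size_filter_le _ _) _; lia.
- by apply: leq_trans (size_filter_le _ _) _; lia.
Qed.

Definition sum_cover (n d : nat) (C : seq nat) : Prop :=
  {subset C <= iota 1 n} /\
  {in iota 1 n &, forall a b, a != b -> d %| a + b -> (a \in C) || (b \in C)}.

Lemma sum_cover_winner n d C h : sum_cover n d C -> remaining C h = [::] ->
  finished n h -> winner n d h = PlayerB.
Proof.
move=> [_ C_cover] C_crossed; rewrite /finished /winner => board2.
have board_notin k : k \in board n h -> (k \in iota 1 n) && (k \notin C).
  rewrite mem_filter => /andP[k_h ->] /=; apply/negP => k_C.
  by have := mem_remaining C h k; rewrite C_crossed k_h k_C.
have : uniq (board n h) by rewrite filter_uniq ?iota_uniq.
case: (board n h) board2 board_notin => [|a [|b []]] //= _ board_notin.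
rewrite inE andbT addn0 => a_neq_b; case: ifP => // d_ab.
have /andP[a_n /negPf a_C] := board_notin a (mem_head _ _).
have /andP[b_n /negPf b_C] : (b \in iota 1 n) && (b \notin C).
  by apply: board_notin; rewrite !inE eqxx orbT.
by have := C_cover a b a_n b_n a_neq_b d_ab; rewrite a_C b_C.
Qed.

Lemma cover_strategy_winning n d C : sum_cover n d C -> 2 * size C + 2 <= n ->
  winning_strategy n d PlayerB (cover_strategy n C).
Proof.
move=> C_cover C_small; split=> h [h_uniq h_sub h_size] B_follows.
- move=> _ _; apply: cover_strategy_board; first by case: C_cover.
  by have := size_board h_uniq h_sub; lia.
- move=> h_fin; apply: (sum_cover_winner C_cover) => //; apply: size0nil.
  have := size_board h_uniq h_sub; rewrite h_fin.
  by have := size_remaining_cover_strategy B_follows; lia.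
Qed.

Lemma dvdn_lt4 d m : 0 < m < 4 * d -> d %| m ->
  [\/ m = d, m = 2 * d | m = 3 * d].
Proof.
move=> m_bounds /dvdnP[[|[|[|[|q]]]] mE]; last by nia.
- by lia.
- by constructor 1; lia.
- by constructor 2; lia.
- by constructor 3; lia.
Qed.

(* Here only the residues below [d / 2] have two representatives. *)
Lemma sum_cover_short_board n d : d <= n -> 2 * n < 3 * d ->
  sum_cover n d (iota d./2.+1 d.-1./2).
Proof.
move=> le_dn lt_nd; split=> [k|a b]; rewrite !mem_iota; first by lia.
by move=> a_n b_n a_neq_b /dvdn_lt4[]; lia.
Qed.

Lemma sum_cover_long_board n d : 3 * d <= 2 * n -> n <= 2 * d ->
  sum_cover n d (iota (uphalf d) d./2 ++ iota (3 * d)./2.+1 (n - (3 * d)./2)).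
Proof.
move=> le_dn le_nd; split=> [k|a b]; rewrite !(mem_cat, mem_iota); first by lia.
by move=> a_n b_n a_neq_b /dvdn_lt4[]; lia.
Qed.

Lemma small_sum_cover n d : n + 2 <= 2 * d -> d < n ->
  exists2 C, sum_cover n d C & 2 * size C + 2 <= n.
Proof.
move=> le_nd lt_dn; have [lt_nd|le_dn] := ltnP (2 * n) (3 * d).
- eexists; first exact: sum_cover_short_board (ltnW lt_dn) lt_nd.
  by rewrite size_iota; lia.
- eexists; first by apply: sum_cover_long_board le_dn _; lia.
  (* The cover has [n - d] elements. *)
  by rewrite size_cat !size_iota; lia.
Qed.

Theorem theorem3p2p1 (n : nat) (hn : 5 <= n) (hodd : odd n) (d : nat)
    (hd1 : n + 3 <= 2 * d) (hd2 : d <= n - 1) :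
  has_winning_strategy n d PlayerB.
Proof.
have [||C C_cover C_small] := @small_sum_cover n d; [lia | lia |].
by exists (cover_strategy n C); apply: cover_strategy_winning.
Qed.
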